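(* Let $n\ge 5$ and let $A\in\mathbb{R}^{n\times n}$ be the clamped-free matrix defined in the context. Let $B=[b_{i,j}]_{i,j=1}^n\in\mathbb{R}^{n\times n}$ be the matrix with entries $$b_{i,j}=\frac{3ij^2+j-j^3}{6}\quad\text{for all } i\in\{1,\dots,n\},\ j\in\{1,\dots,n-1\}\text{ with } j\le i,$$ $$b_{i,n}=\tfrac12\, b_{n,i}\quad\text{for } i\in\{1,\dots,n-1\},$$ $$b_{n,n}=\tfrac{1}{12}\,n(2n^2+1),$$ $$b_{i,j}=b_{j,i}\quad\text{for } i,j\in\{1,\dots,n-1\}.$$ Then $A$ is nonsingular and $B$ is the inverse of $A$.
   Context: The clamped-free matrix $A=[a_{i,j}]_{i,j=1}^n$ (for an integer $n\ge5$) is the pentadiagonal matrix whose nonzero entries are: main diagonal: $a_{1,1}=7$, $a_{i,i}=6$ for $2\le i\le n-2$, $a_{n-1,n-1}=5$, $a_{n,n}=2$; first superdiagonal: $a_{i,i+1}=-4$ for $1\le i\le n-2$, $a_{n-1,n}=-2$; first subdiagonal: $a_{i,i-1}=-4$ for $2\le i\le n$; second superdiagonal: $a_{i,i+2}=1$ for $1\le i\le n-2$; second subdiagonal: $a_{i,i-2}=1$ for $3\le i\le n-1$, $a_{n,n-2}=2$. All other entries are $0$. *)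

(* Defs.v *)
From HB Require Import structures.
From mathcomp Require Import all_boot all_order all_algebra.
From mathcomp Require Import reals.
Set Implicit Arguments.
Unset Strict Implicit.
Unset Printing Implicit Defensive.
Import Order.TTheory GRing.Theory Num.Theory.
Local Open Scope ring_scope.

(* The entry functions below take 1-based indices (1 <= i, j <= n); the
   matrices shift the 0-based indices of 'I_n accordingly. *)

Definition clamped_free_entry (R : realType) (n i j : nat) : R :=
  if j == i then
    if i == 1%N then 7
    else if (i <= n - 2)%N then 6
    else if i == (n - 1)%N then 5
    else 2
  else if j == (i + 1)%N then
    if i == (n - 1)%N then - 2 else - 4
  else if i == (j + 1)%N then - 4
  else if j == (i + 2)%N then 1
  else if i == (j + 2)%N then
    if i == n then 2 else 1
  else 0.

Definition clamped_free (R : realType) (n : nat) : 'M[R]_n :=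
  \matrix_(i, j) clamped_free_entry R n i.+1 j.+1.

Definition lower_entry (R : realType) (i j : nat) : R :=
  (3 * i%:R * j%:R ^+ 2 + j%:R - j%:R ^+ 3) / 6.

(* When i < n, b_{n,i} is given by [lower_entry R n i]. *)
Definition B_entry (R : realType) (n i j : nat) : R :=
  if j == n then
    if i == n then 1 / 12 * n%:R * (2 * n%:R ^+ 2 + 1)
    else 1 / 2 * lower_entry R n i
  else if (j <= i)%N then lower_entry R i j
  else lower_entry R j i.

Definition B_matrix (R : realType) (n : nat) : 'M[R]_n :=
  \matrix_(i, j) B_entry R n i.+1 j.+1.

(* Main.v *)
Require Import Defs.
From HB Require Import structures.
From mathcomp Require Import all_boot all_order all_algebra.
From mathcomp Require Import reals.
From mathcomp Require Import zify ring.
Import Order.TTheory GRing.Theory Num.Theory.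
Local Open Scope ring_scope.

(** The matrix is the discrete biharmonic operator, and its inverse is the
    discrete Green function of a beam.  Extend a vector by two ghost values at
    each end, subject to the clamped condition on the left ([u_0 = 0] and
    [u_{-1} = u_1]) and to the free condition on the right (linear extension
    past [n]).  Eliminating the ghost values from the fourth difference
    stencil (1, -4, 6, -4, 1) gives exactly the rows of the matrix, the last
    one being multiplied by two: this is [sum_clamped_free_entry].

    For a load at [j], the vector [green j] equal to [beam j x] for [x <= j]
    and to [beam x j] for [x >= j], where [beam x y = (3xy^2 + y - y^3)/6],
    meets these end conditions.  It is cubic before [j] and linear after [j],
    and the two pieces differ by [((x-j)^3 - (x-j))/6], which vanishes at
    [x = j-1], [j] and [j+1].  So any stencil not centred at [j] sees a single
    polynomial of degree at most three, which it annihilates, while the one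
    centred at [j] returns 1 ([fourth_diff_green]).

    Column [j] of the candidate inverse is [green j], halved for [j = n]; this
    half cancels the factor two of the last row, so that the product of the
    two matrices is the identity. *)

(** Positions are shifted by two: [u m] is the value at the node [m - 1], so
    that the ghost nodes -1 and 0 have natural number indices and the stencil
    centred at the 0-based row [i] starts at index [i]. *)
Definition fourth_diff {R : realType} (u : nat -> R) (m : nat) : R :=
  u m - 4 * u m.+1 + 6 * u m.+2 - 4 * u m.+3 + u m.+4.

Lemma sum_window5 (R : realType) (n a : nat) (F : nat -> R) :
  (a + 5 <= n)%N ->
  (forall k, (k < a)%N || (a + 5 <= k < n)%N -> F k = 0) ->
  \sum_(k < n) F k = F a + F a.+1 + F a.+2 + F a.+3 + F a.+4.
Proof.
move=> le_an F0; rewrite -(big_mkord xpredT).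
rewrite (big_cat_nat (n := a)) //=; last by lia.
rewrite (big_cat_nat (m := a) (n := a + 5)) ?leq_addr //=.
rewrite [X in X + _]big_nat_cond big1 ?add0r; last by move=> k ?; apply: F0; lia.
rewrite [X in _ + X]big_nat_cond [X in _ + X]big1 ?addr0;
  last by move=> k ?; apply: F0; lia.
by rewrite -{1}[a]add0n big_addn addKn !big_nat_recl // big_geq //= addr0 !addrA.
Qed.

Ltac entry_cases := rewrite /clamped_free_entry;
  repeat (match goal with |- context [if ?b then _ else _] =>
            let E := fresh in case E : b; try (exfalso; lia) end).

Lemma clamped_free_entry_far (R : realType) (n i k : nat) :
  (k + 2 < i)%N || (i + 2 < k)%N -> clamped_free_entry R n i k = 0.
Proof. by move=> ?; entry_cases. Qed.

(** Eliminating the four ghost values from the stencil yields the modified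
    boundary coefficients 7, 5, 2 and -2; since the free end leaves
    [u_{n-2} - 2 u_{n-1} + u_n] in the last row, whose entries are 2, -4, 2,
    that row gets the factor two. *)
Lemma sum_clamped_free_entry (R : realType) (n i : nat) (u : nat -> R) :
  (5 <= n)%N -> (i < n)%N ->
  u 1 = 0 -> u 0 = u 2 ->
  u n.+2 = 2 * u n.+1 - u n -> u n.+3 = 2 * u n.+2 - u n.+1 ->
  \sum_(k < n) clamped_free_entry R n i.+1 k.+1 * u k.+2
    = (if i.+1 == n then 2 else 1) * fourth_diff u i.
Proof.
move=> n5 lt_in u1 u0 un2 un3.
(* As n >= 5, five consecutive columns can be chosen inside the matrix so as
   to contain the support of row i, even at the two ends. *)
pose a := minn (i - 2) (n - 5).
have def_a : a = minn (i - 2) (n - 5) by [].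
clearbody a.
rewrite (@sum_window5 _ n a
  (fun k => clamped_free_entry R n i.+1 k.+1 * u k.+2)); first last.
- by move=> k ?; rewrite clamped_free_entry_far ?mul0r //; lia.
- by lia.
(* Each row with a special coefficient, and the generic row, is located
   relative to the window, so that all entries can be computed. *)
have cases : (i = 0 /\ a = 0 \/ i = 1 /\ a = 0 \/
    i = a.+2 /\ a.+3 < n - 1 \/ i = a.+3 /\ n = a.+4.+1 \/
    i = a.+4 /\ n = a.+4.+1)%N by lia.
clear def_a; rewrite /fourth_diff.
case: cases un2 un3 n5 lt_in => [[-> ->]|[[-> ->]|[[-> ?]|[[-> ->]|[-> ->]]]]]
  un2 un3 n5 lt_in.
- by entry_cases; rewrite u0 u1; ring.
- by entry_cases; rewrite u1; ring.
- by entry_cases; ring.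
- by entry_cases; rewrite un2; ring.
- by entry_cases; rewrite un3 un2; ring.
Qed.

(** [lower_entry] at arbitrary real positions, as needed at the ghost nodes. *)
Definition beam {R : realType} (x y : R) : R :=
  (3 * x * y ^+ 2 + y - y ^+ 3) / 6.

Lemma beam_sub (R : realType) (x y : R) :
  beam x y = beam y x + ((x - y) ^+ 3 - (x - y)) / 6.
Proof. by rewrite /beam; field. Qed.

Definition green (R : realType) (j m : nat) : R :=
  if (m <= j.+1)%N then beam j%:R (m%:R - 1) else beam (m%:R - 1) j%:R.

(** The cubic piece remains valid one node past the load, where the
    difference of the two pieces still vanishes. *)
Lemma green_left (R : realType) (j m : nat) :
  (m <= j.+2)%N -> green R j m = beam j%:R (m%:R - 1).
Proof.
rewrite /green; case: ifP => // ? ?.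
have -> : m = j.+2 by lia.
by rewrite beam_sub /beam; field.
Qed.

(** Symmetrically, the linear piece is already valid one node before it. *)
Lemma green_right (R : realType) (j m : nat) :
  (j <= m)%N -> green R j m = beam (m%:R - 1) j%:R.
Proof.
rewrite /green; case: ifP => // ? ?.
have [->|->] : m = j \/ m = j.+1 by lia.
  by rewrite beam_sub /beam; field.
by rewrite beam_sub /beam; field.
Qed.

(** The one-node overlap of the two pieces on each side of the load is what
    makes every stencil centred away from [j] lie within a single piece. *)
Lemma fourth_diff_green (R : realType) (j i : nat) :
  fourth_diff (green R j) i = (i.+1 == j)%:R.
Proof.
rewrite /fourth_diff; case: ltngtP => [lt_ij|lt_ji|eq_ij];
  rewrite ?mulr0n ?mulr1n.
- by rewrite !green_left; try lia; rewrite /beam; field.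
- by rewrite !green_right; try lia; rewrite /beam; field.
- rewrite -eq_ij (green_right _ _ i.+3); last by lia.
  rewrite (green_right _ _ i.+4); last by lia.
  rewrite !green_left; try lia.
  by rewrite /beam; field.
Qed.

Lemma B_entryE (R : realType) (n i j : nat) : (i < n)%N -> (j < n)%N ->
  B_entry R n i.+1 j.+1 = (if j.+1 == n then 1 / 2 else 1) * green R j.+1 i.+2.
Proof.
move=> lt_in lt_jn; rewrite /B_entry.
have natB1 m : m.+1%:R - 1 = m%:R :> R by rewrite -natr1 addrK.
case: eqP => [eq_jn|_].
  rewrite green_left ?natB1 -?eq_jn; last by lia.
  by case: eqP => [->|_]; rewrite /lower_entry /beam; field.
rewrite mul1r; case: ifP => le_ji.
  by rewrite green_right ?natB1 //; lia.
by rewrite green_left ?natB1 //; lia.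
Qed.

Lemma clamped_free_mulB (R : realType) (n : nat) : (5 <= n)%N ->
  clamped_free R n *m B_matrix R n = 1%:M.
Proof.
move=> n5; apply/matrixP => i j; rewrite !mxE.
have lt_in := ltn_ord i; have lt_jn := ltn_ord j.
pose c : R := if j.+1 == n then 1 / 2 else 1.
transitivity (c * \sum_(k < n)
    clamped_free_entry R n i.+1 k.+1 * green R j.+1 k.+2).
  rewrite mulr_sumr; apply: eq_bigr => k _.
  by rewrite !mxE B_entryE // mulrCA.
rewrite sum_clamped_free_entry //.
- rewrite fourth_diff_green eqSS -val_eqE /c /=.
  case: (eqVneq (i : nat) j) => [->|_]; last by rewrite !mulr0.
  by case: ifP => _; field.
- by rewrite green_left // /beam; field.
- by rewrite !green_left // /beam; field.
- by rewrite !green_right; try lia; rewrite /beam; field.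
- by rewrite !green_right; try lia; rewrite /beam; field.
Qed.

Theorem theorem2p1 (R : realType) (n : nat) (hn : (5 <= n)%N) :
  clamped_free R n \in unitmx /\ invmx (clamped_free R n) = B_matrix R n.
Proof.
have AB1 := clamped_free_mulB R n hn.
have [A_unit _] := mulmx1_unit AB1; split=> //.
by rewrite -[RHS](mulKmx A_unit) AB1 mulmx1.
Qed.
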